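(* Let the source data $(X_S,Y_S)$, kernel $k$, kernel matrix $K_S=k(X_S,X_S)$, $\sigma_S>0$, source model $f_S(\cdot)^T=k(\cdot,X_S)[K_S+\sigma_S I]^{-1}Y_S$, input transformation $a:\mathbb{R}^{d_T}\to\mathbb{R}^{d_S}$, and target feature matrix $X_T$ be as in the context, and let $\Theta_T^B(x,x')=f_S(a(x))^Tf_S(a(x'))$ be the kernel induced by the trainable linear output mapping. Suppose that $c_B>0$ is such that $$\lambda_{\min}\big[k(a(X_T),X_S)\,k(X_S,a(X_T))\big]\ge c_B\,(\lambda_{\max}[K_S])^2 .$$ Then for every $i\in\{1,\dots,N_T\}$, $$\lambda_i\big(\Theta_T^B(X_T,X_T)\big)\ge c_B\cdot\left[\frac{\lambda_{\min}[K_S]}{\lambda_{\min}[K_S]+\sigma_S}\right]^2\cdot\lambda_{\min}[Y_SY_S^T].$$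
   Context: Source data: $X_S=[x_s^1,\dots,x_s^{N_S}]^T\in\mathbb{R}^{N_S\times d_S}$, $Y_S=[y_s^1,\dots,y_s^{N_S}]^T\in\mathbb{R}^{N_S\times c_S}$. Target features: $x_1,\dots,x_{N_T}\in\mathbb{R}^{d_T}$, the rows of $X_T\in\mathbb{R}^{N_T\times d_T}$. The kernel $k:\mathbb{R}^{d_S}\times\mathbb{R}^{d_S}\to\mathbb{R}$ is symmetric and positive semi-definite, $k(x,x')=\langle\Phi(x),\Phi(x')\rangle$ for a feature map $\Phi$ (it is induced by the neural tangent kernel of the source network). For finite sequences of points $U=(u_i)$, $V=(v_j)$, $k(U,V)$ is the matrix with entries $k(u_i,v_j)$; $a(X_T)$ is the sequence $a(x_1),\dots,a(x_{N_T})$. Thus $K_S=k(X_S,X_S)$ is $N_S\times N_S$ and $k(a(X_T),X_S)=k(X_S,a(X_T))^T$ is $N_T\times N_S$. The source model $f_S:\mathbb{R}^{d_S}\to\mathbb{R}^{c_S}$ is $f_S(x)^T=k(x,X_S)[K_S+\sigma_S I]^{-1}Y_S$, $\sigma_S>0$. The target model is $f_T(x)=b\,f_S(a(x))$, where the output mapping $b$ is an arbitrary $c_T\times c_S$ matrix with all entries trainable; its neural tangent kernel with respect to the entries of $b$ is $\hat\Theta_T^B(x,x')=[f_S(a(x))^Tf_S(a(x'))]\otimes I_{c_T}$, and $\Theta_T^B(x,x')=f_S(a(x))^Tf_S(a(x'))$ is the corresponding scalar kernel. $\Theta_T^B(X_T,X_T)$ is the $N_T\times N_T$ matrix with entries $\Theta_T^B(x_i,x_j)$.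 For a symmetric matrix, $\lambda_i$ is the $i$-th largest eigenvalue, and $\lambda_{\max},\lambda_{\min}$ are the largest and smallest eigenvalues. *)

(* Defs.v *)
From mathcomp Require Import all_boot all_order all_algebra.
From mathcomp Require Import reals.
From mathcomp Require Import polyrcf.

Set Implicit Arguments.
Unset Strict Implicit.
Unset Printing Implicit Defensive.

Import Order.TTheory GRing.Theory Num.Theory.
Local Open Scope ring_scope.

Section Spectrum.
Context {R : rcfType}.

(* The real roots of the characteristic polynomial, each repeated according to
   its multiplicity, in nonincreasing order.  For a symmetric A of size n this
   list has exactly n entries. *)
Definition spectrum n (A : 'M[R]_n) : seq R :=
  sort >=%R (flatten [seq nseq (mup x (char_poly A)) x
                     | x <- rootsR (char_poly A)]).

(* 0-based: [eigval A 0] is the largest eigenvalue, so the ordinal i : 'I_n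
   stands for the (i+1)-st largest one. *)
Definition eigval n (A : 'M[R]_n) (i : nat) : R := nth 0 (spectrum A) i.

(* Meaningful for symmetric matrices of positive size (otherwise the spectrum
   may be empty and both default to 0). *)
Definition lambda_max n (A : 'M[R]_n) : R := head 0 (spectrum A).
Definition lambda_min n (A : 'M[R]_n) : R := last 0 (spectrum A).

Lemma mem_spectrum n (A : 'M[R]_n) x : (x \in spectrum A) = eigenvalue A x.
Proof.
have p0 : char_poly A != 0 by rewrite monic_neq0 ?char_poly_monic.
have in_roots y : (y \in rootsR (char_poly A)) = root (char_poly A) y.
  by have := roots_on_rootsR p0 y; rewrite in_itv /= => <-.
rewrite eigenvalue_root_char mem_sort; apply/flatten_mapP/idP => [[y]|rx].
  by rewrite in_roots mem_nseq => ry /andP[_ /eqP->].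
exists x; rewrite ?in_roots // mem_nseq eqxx andbT.
by rewrite -XsubC_dvd // dvdp_XsubCl.
Qed.

End Spectrum.

Section Models.
Context {R : realType}.

(* Points of R^d are column vectors; a data matrix stores them as rows. *)
Definition samples N d (X : 'M[R]_(N, d)) : 'I_N -> 'cV[R]_d :=
  fun i => (row i X)^T.

Definition psd_kernel (T : Type) (k : T -> T -> R) : Prop :=
  (forall x y, k x y = k y x) /\
  (forall n (x : 'I_n -> T) (c : 'I_n -> R),
     0 <= \sum_i \sum_j c i * c j * k (x i) (x j)).

(* A kernel given by a feature map into a real inner product space of
   arbitrary dimension is positive semi-definite in the above sense. *)
Lemma psd_kernel_feature (T : Type) (H : lmodType R) (dot : {dot H for idfun})
    (Phi : T -> H) : psd_kernel (fun x y => dot (Phi x) (Phi y)).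
Proof.
split=> [x y|n x c]; first by rewrite hermC /= expr0 mul1r.
have -> : \sum_i \sum_j c i * c j * dot (Phi (x i)) (Phi (x j)) =
    dot (\sum_i c i *: Phi (x i)) (\sum_j c j *: Phi (x j)).
  rewrite linear_sumlz; apply: eq_bigr => i _.
  rewrite linear_sumr; apply: eq_bigr => j _.
  by rewrite linearZl_LR linearZr_LR /= mulrA.
set v := \sum_i _; have [->|v0] := eqVneq v 0; first by rewrite linear0l.
by rewrite ltW // neq0_dnorm_gt0.
Qed.

Definition kmx (T : Type) (k : T -> T -> R) m n
    (U : 'I_m -> T) (V : 'I_n -> T) : 'M[R]_(m, n) :=
  \matrix_(i, j) k (U i) (V j).

Definition source_model N d c (k : 'cV[R]_d -> 'cV[R]_d -> R)
    (X : 'M[R]_(N, d)) (Y : 'M[R]_(N, c)) (sigma : R)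
    (x : 'cV[R]_d) : 'cV[R]_c :=
  (kmx k (fun _ : 'I_1 => x) (samples X)
   *m invmx (kmx k (samples X) (samples X) + sigma%:M) *m Y)^T.

(* The scalar kernel of x |-> b *m f (a x) with all entries of b trainable. *)
Definition theta_B dT dS c (f : 'cV[R]_dS -> 'cV[R]_c)
    (a : 'cV[R]_dT -> 'cV[R]_dS) (x x' : 'cV[R]_dT) : R :=
  ((f (a x))^T *m f (a x')) 0 0.

End Models.

(* Main.v *)
(* Theta = B B^T with B = T (K_S + sigma I)^-1 Y_S and T = k(a(X_T), X_S).  For a
   row v put u = v T (K_S + sigma I)^-1, so that u (K_S + sigma I) = v T.  Then
   v Theta v^T >= lambda_min(Y Y^T) |u|^2, while
   (lambda_max(K_S) + sigma)^2 |u|^2 >= |v T|^2 >= c_B lambda_max(K_S)^2 |v|^2,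
   and t / (t + sigma) increases with t. *)
Require Import Defs.
From mathcomp Require Import all_boot all_order all_algebra.
From mathcomp Require Import reals polyrcf complex ring.

Set Implicit Arguments.
Unset Strict Implicit.
Unset Printing Implicit Defensive.

Import Order.TTheory GRing.Theory Num.Theory.
Local Open Scope ring_scope.

(** The scalar matrix of the indeterminate commutes with [P], so the whole characteristic matrix
    gets conjugated and the determinants of the two conjugators cancel. *)
Lemma char_poly_invmx_conj (F : comUnitRingType) n (P A : 'M[F]_n) :
  P \in unitmx -> char_poly (invmx P *m A *m P) = char_poly A.
Proof.
move=> Pu; rewrite /char_poly.
have PK : map_mx polyC (invmx P) *m map_mx polyC P = 1%:M.
  by rewrite -map_mxM mulVmx // map_mx1.
have -> : char_poly_mx (invmx P *m A *m P) =
    map_mx polyC (invmx P) *m char_poly_mx A *m map_mx polyC P.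
  rewrite /char_poly_mx mulmxBr mulmxBl -!map_mxM; congr (_ - _).
  by rewrite -mulmxA -scalar_mxC mulmxA PK mul1mx.
by rewrite !det_mulmx mulrAC -det_mulmx PK det1 mul1r.
Qed.

(** * Spectra of real symmetric matrices *)

Section SymmetricSpectrum.
Context {R : rcfType}.

(** Once the characteristic polynomial splits, the multiplicity of a root is its count in [s], so
    both lists group the same copies. *)
Lemma perm_spectrum n (A : 'M[R]_n) (s : seq R) :
  char_poly A = \prod_(x <- s) ('X - x%:P) -> perm_eq (spectrum A) s.
Proof.
move=> As; rewrite /spectrum perm_sort.
have p0 : char_poly A != 0 by rewrite monic_neq0 ?char_poly_monic.
apply: perm_trans (perm_count_undup s); apply/perm_flatten.
rewrite (@eq_map _ _ _ (fun x => nseq (count_mem x s) x)); last first.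
  by move=> x; rewrite As mu_prod_XsubC.
apply/perm_map/uniq_perm; [exact: uniq_roots|exact: undup_uniq|].
move=> x; have := roots_on_rootsR p0 x; rewrite in_itv /= => <-.
by rewrite As root_prod_XsubC mem_undup.
Qed.

Local Open Scope complex_scope.
Local Open Scope sesquilinear_scope.

(* The weights [w] are the squared moduli of the coordinates of [v] in a unitary
   eigenbasis of A over R[i], which keeps the complex basis out of the
   statement. *)
Lemma symmetric_spectral n (A : 'M[R]_n) : A^T = A ->
  exists2 d : 'I_n -> R, perm_eq (spectrum A) [seq d i | i <- enum 'I_n] &
  forall v : 'rV[R]_n, exists w : 'I_n -> R, [/\ forall i, 0 <= w i,
    (v *m v^T) 0 0 = \sum_i w i,
    (v *m A *m v^T) 0 0 = \sum_i d i * w i &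
    (v *m A *m (v *m A)^T) 0 0 = \sum_i d i ^+ 2 * w i].
Proof.
move=> Asym; pose toC := real_complex R.
have reC m p (B : 'M[R]_(m, p)) : map_mx toC B \is a mxOver Num.real.
  by apply/mxOverP => i j; rewrite mxE complex_real.
have trC m p (B : 'M[R]_(m, p)) : (map_mx toC B)^t* = map_mx toC B^T.
  by rewrite map_trmx realmxC.
have herm : map_mx toC A \is hermsymmx.
  apply: realsym_hermsym => //; apply/is_hermitianmxP.
  by rewrite expr0 scale1r map_mx_id // map_trmx Asym.
(* Over [R[i]] the matrix is Hermitian, hence normal: it is unitarily diagonalizable, and its
   eigenvalues are real. *)
have /hermitian_normalmx/orthomx_spectralP := herm.
have /mxOverP Dreal := hermitian_spectral_diag_real herm.
have Puni := spectral_unitarymx (map_mx toC A).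
set P := spectralmx _ in Puni *; set D := spectral_diag _ in Dreal *.
move=> AE.
pose d i := complex.Re (D 0 i); have dE i : D 0 i = (d i)%:C.
  by rewrite [RHS]RRe_real.
exists d.
  (* The factorization is proved over [R[i]], where A is conjugate to a diagonal matrix, and
     descends because the embedding of polynomials is injective. *)
  apply: perm_spectrum; apply: (@map_inj_poly _ _ toC (@complexI R)) => //.
  rewrite map_char_poly -/toC AE char_poly_invmx_conj ?spectral_unit //.
  rewrite char_poly_trig ?diag_mx_is_trig // big_map big_enum /=.
  rewrite rmorph_prod /=; apply: eq_bigr => i _.
  by rewrite map_polyXsubC mxE eqxx mulr1n dE.
move=> v; pose W := map_mx toC v *m P^t*.
pose w i := complex.Re (W 0 i * (W 0 i)^*%R).
have wE i : W 0 i * (W 0 i)^*%R = (w i)%:C.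
  by rewrite [RHS]RRe_real // ger0_real // mul_conjC_ge0.
have vE : map_mx toC v = W *m P.
  by rewrite /W -invmx_unitary // mulmxKV // unitarymx_unit.
have PP : P *m P^t* = 1%:M by apply/unitarymxP.
have vAE : map_mx toC (v *m A) = W *m diag_mx D *m P.
  rewrite map_mxM AE vE (invmx_unitary Puni) !mulmxA -(mulmxA W) PP.
  by rewrite mulmx1.
(* For real rows the transpose is the conjugate transpose, and [P] is unitary, so a dot product is
   the Hermitian product of the coordinates. The three identities use the coordinates [W] of v and
   [W *m diag_mx D] of v A. *)
have entry (x y : 'rV[R]_n) (X Y : 'rV[R[i]]_n) : map_mx toC x = X *m P ->
    map_mx toC y = Y *m P ->
    ((x *m y^T) 0 0)%:C = \sum_i X 0 i * (Y 0 i)^*%R.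
  move=> xE yE; have -> : ((x *m y^T) 0 0)%:C = (map_mx toC (x *m y^T)) 0 0.
    by rewrite [RHS]mxE.
  rewrite map_mxM -trC xE yE trmx_mul map_mxM mulmxA -(mulmxA X) PP mulmx1.
  by rewrite mxE; apply: eq_bigr => i _; rewrite !mxE.
have WD i : (W *m diag_mx D) 0 i = W 0 i * (d i)%:C.
  by rewrite mul_mx_diag !mxE dE.
exists w; split.
- by move=> i; rewrite -lecR -wE mul_conjC_ge0.
- apply: (@complexI R); rewrite (entry _ _ _ _ vE vE) rmorph_sum.
  by apply: eq_bigr => i _; rewrite wE.
- apply: (@complexI R); rewrite (entry _ _ _ _ vAE vE) rmorph_sum.
  apply: eq_bigr => i _; rewrite WD mulrAC wE -rmorphM /=; congr (_%:C).
  exact: mulrC.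
have WDJ i : ((W *m diag_mx D) 0 i)^*%R = (W 0 i)^*%R * (d i)%:C.
  by rewrite WD rmorphM /= [X in _ * X]conj_Creal ?complex_real.
apply: (@complexI R); rewrite (entry _ _ _ _ vAE vAE) rmorph_sum.
apply: eq_bigr => i _; rewrite WDJ WD mulrACA wE -!rmorphM /=.
by congr (_%:C); rewrite mulrC expr2.
Qed.

Lemma size_spectrum n (A : 'M[R]_n) : A^T = A -> size (spectrum A) = n.
Proof.
move=> /symmetric_spectral[d /perm_size-> _].
by rewrite size_map size_enum_ord.
Qed.

Lemma spectrum_sorted n (A : 'M[R]_n) : sorted >=%R (spectrum A).
Proof. exact/sort_sorted/ge_total. Qed.

Lemma le_lambda_max n (A : 'M[R]_n) x : x \in spectrum A -> x <= lambda_max A.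
Proof.
rewrite /lambda_max; have := spectrum_sorted A.
case: (spectrum A) => //= y s /(order_path_min ge_trans)/allP ys.
by rewrite inE => /predU1P[->//|/ys].
Qed.

Lemma lambda_min_le n (A : 'M[R]_n) x : x \in spectrum A -> lambda_min A <= x.
Proof.
rewrite /lambda_min; have := spectrum_sorted A.
case/lastP: (spectrum A) => // s y; rewrite last_rcons -rev_sorted rev_rcons.
move=> /(order_path_min le_trans)/allP ys.
by rewrite mem_rcons inE => /predU1P[->//|xs]; apply: ys; rewrite mem_rev.
Qed.

(** The spectrum has n > 0 entries, so the default 0 of [last] is not reached. *)
Lemma mem_lambda_min n (A : 'M[R]_n) :
  (0 < n)%N -> A^T = A -> lambda_min A \in spectrum A.
Proof.
move=> n0 /size_spectrum; rewrite /lambda_min.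
case: (spectrum A) => [e|x s _ /=]; first by rewrite -e in n0.
exact: mem_last.
Qed.

(** * Eigenvalue bounds and quadratic forms *)

Lemma lambda_min_rayleigh n (A : 'M[R]_n) (v : 'rV[R]_n) : A^T = A ->
  lambda_min A * (v *m v^T) 0 0 <= (v *m A *m v^T) 0 0.
Proof.
move=> /symmetric_spectral[d dA /(_ v)[w [w0 -> -> _]]].
rewrite mulr_sumr; apply: ler_sum => i _; apply: ler_wpM2r => //.
by apply: lambda_min_le; rewrite (perm_mem dA) map_f ?mem_enum.
Qed.

Lemma row_sqr_ge0 n (v : 'rV[R]_n) : 0 <= (v *m v^T) 0 0.
Proof. by rewrite mxE sumr_ge0 // => i _; rewrite mxE -expr2 sqr_ge0. Qed.

Lemma row_sqr_gt0 n (v : 'rV[R]_n) : v != 0 -> 0 < (v *m v^T) 0 0.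
Proof.
move=> v0; rewrite lt_def row_sqr_ge0 andbT mxE; apply: contra v0.
rewrite psumr_eq0 => [/allP v0|i _]; last by rewrite mxE -expr2 sqr_ge0.
apply/eqP/rowP => i; have /= := v0 i (mem_index_enum _).
by rewrite !mxE mulf_eq0 orbb => /eqP.
Qed.

(** Test the form on an eigenvector for x and divide by its positive squared norm. *)
Lemma le_spectrum n (A : 'M[R]_n) c x :
  (forall v : 'rV[R]_n, c * (v *m v^T) 0 0 <= (v *m A *m v^T) 0 0) ->
  x \in spectrum A -> c <= x.
Proof.
move=> cA; rewrite mem_spectrum => /eigenvalueP[v vA v0].
by have := cA v; rewrite vA -scalemxAl [leRHS]mxE ler_pM2r // row_sqr_gt0.
Qed.

Lemma lambda_min_ge0 n (A : 'M[R]_n) : A^T = A ->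
  (forall v : 'rV[R]_n, 0 <= (v *m A *m v^T) 0 0) -> 0 <= lambda_min A.
Proof.
case: n A => [|n] A Asym A0.
  (* In size 0 the spectrum is empty and [lambda_min] is its default 0. *)
  by rewrite /lambda_min (size0nil (size_spectrum Asym)).
by apply: le_spectrum (mem_lambda_min _ Asym) => // v; rewrite mul0r.
Qed.

(** In an eigenbasis the shifted matrix scales each coordinate by [d i + s], which lies between 0
    and [lambda_max A + s]. *)
Lemma lambda_max_shift n (A : 'M[R]_n) s (v : 'rV[R]_n) : A^T = A ->
  (forall v : 'rV[R]_n, 0 <= (v *m A *m v^T) 0 0) -> 0 <= s ->
  let u := v *m (A + s%:M) in
  (u *m u^T) 0 0 <= (lambda_max A + s) ^+ 2 * (v *m v^T) 0 0.
Proof.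
move=> Asym A0 s0 /=.
have -> : v *m (A + s%:M) = v *m A + s *: v.
  by rewrite mulmxDr mul_mx_scalar.
have -> : ((v *m A + s *: v) *m (v *m A + s *: v)^T) 0 0 =
    (v *m A *m (v *m A)^T) 0 0 + (s * 2) * (v *m A *m v^T) 0 0 +
    s ^+ 2 * (v *m v^T) 0 0.
  move: (v *m A) => u; rewrite !mxE !mulr_sumr -!big_split.
  by apply: eq_bigr => i _; rewrite !mxE /=; ring.
have [d dA /(_ v)[w [w0 -> -> ->]]] := symmetric_spectral Asym.
rewrite !mulr_sumr -!big_split /=; apply: ler_sum => i _.
have dspec : d i \in spectrum A by rewrite (perm_mem dA) map_f ?mem_enum.
have di0 : 0 <= d i by apply: le_spectrum dspec => u; rewrite mul0r.
have -> : d i ^+ 2 * w i + s * 2 * (d i * w i) + s ^+ 2 * w i =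
  (d i + s) ^+ 2 * w i by ring.
have dmax := le_lambda_max dspec.
have max0 := le_trans di0 dmax.
by rewrite ler_wpM2r // lerXn2r ?nnegrE ?addr_ge0 ?lerD2r.
Qed.

(** A nonzero v in the left kernel would give 0 = v A v^T + s |v|^2 > 0. *)
Lemma shift_unitmx n (A : 'M[R]_n) s :
  (forall v : 'rV[R]_n, 0 <= (v *m A *m v^T) 0 0) -> 0 < s ->
  A + s%:M \in unitmx.
Proof.
move=> A0 s0; rewrite -row_free_unit -kermx_eq0; apply/rowV0P => v.
move=> /sub_kermxP; rewrite mulmxDr mul_mx_scalar => vAs.
have := congr1 (fun u => (u *m v^T) 0 0) vAs.
rewrite mul0mx mulmxDl -scalemxAl !mxE => /eqP vAs0.
apply/eqP; apply: contraTT vAs0 => /row_sqr_gt0 v0; rewrite gt_eqF //.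
have := A0 v; rewrite !mxE in v0 * => ?.
by rewrite ltr_wpDl // mulr_gt0.
Qed.

End SymmetricSpectrum.

Lemma trmx_kmx (R : realType) (T : Type) (k : T -> T -> R) m n
    (U : 'I_m -> T) (V : 'I_n -> T) :
  (forall x y, k x y = k y x) -> (kmx k U V)^T = kmx k V U.
Proof. by move=> ks; apply/matrixP => i j; rewrite !mxE. Qed.

Lemma kmx_psd (R : realType) (T : Type) (k : T -> T -> R) n (U : 'I_n -> T)
    (v : 'rV[R]_n) :
  psd_kernel k -> 0 <= (v *m kmx k U U *m v^T) 0 0.
Proof.
move=> [_ /(_ _ U (v 0))]; congr (0 <= _).
rewrite mxE exchange_big; apply: eq_bigr => j _.
rewrite !mxE mulr_suml; apply: eq_bigr => i _.
by rewrite !mxE mulrAC.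
Qed.

(** The transposed source output at the l-th point is row l of [B], so the kernel matrix is the Gram
    matrix of these rows. *)
Lemma kmx_theta_B (R : realType) N_S N_T d_S d_T c_S
    (X_S : 'M[R]_(N_S, d_S)) (Y_S : 'M[R]_(N_S, c_S)) (x : 'I_N_T -> 'cV[R]_d_T)
    (k : 'cV[R]_d_S -> 'cV[R]_d_S -> R) (a : 'cV[R]_d_T -> 'cV[R]_d_S) s :
  let B := kmx k (a \o x) (samples X_S) *m
    invmx (kmx k (samples X_S) (samples X_S) + s%:M) *m Y_S in
  kmx (theta_B (source_model k X_S Y_S s) a) x x = B *m B^T.
Proof.
move=> B; apply/matrixP => i j; rewrite !mxE /theta_B.
have fE l : (source_model k X_S Y_S s (a (x l)))^T = row l B.
  rewrite /source_model trmxK /B !row_mul; congr (_ *m _ *m _).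
  by apply/rowP => m; rewrite !mxE.
rewrite fE -[source_model _ _ _ _ (a (x j))]trmxK fE mxE.
by apply: eq_bigr => m _; rewrite !mxE.
Qed.

(** * Eigenvalue bound for the output-mapping kernel *)

Theorem corollary2 (R : realType) (N_S N_T d_S d_T c_S : nat)
    (X_S : 'M[R]_(N_S, d_S)) (Y_S : 'M[R]_(N_S, c_S)) (X_T : 'M[R]_(N_T, d_T))
    (k : 'cV[R]_d_S -> 'cV[R]_d_S -> R) (a : 'cV[R]_d_T -> 'cV[R]_d_S)
    (sigma_S c_B : R)
    (N_S_gt0 : (0 < N_S)%N) (N_T_gt0 : (0 < N_T)%N)
    (k_psd : psd_kernel k) (sigma_S_gt0 : 0 < sigma_S) (c_B_gt0 : 0 < c_B) :
  let K_S := kmx k (samples X_S) (samples X_S) in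
  let aX_T := a \o samples X_T in
  let f_S := source_model k X_S Y_S sigma_S in
  let Theta := kmx (theta_B f_S a) (samples X_T) (samples X_T) in
  c_B * lambda_max K_S ^+ 2
    <= lambda_min (kmx k aX_T (samples X_S) *m kmx k (samples X_S) aX_T) ->
  forall i : 'I_N_T,
    c_B * (lambda_min K_S / (lambda_min K_S + sigma_S)) ^+ 2
        * lambda_min (Y_S *m Y_S^T)
      <= eigval Theta i.

Proof.
move=> K_S aX_T f_S Theta hc i.
have [k_sym _] := k_psd.
have Ksym : K_S^T = K_S by exact: trmx_kmx.
have K0 (v : 'rV_N_S) : 0 <= (v *m K_S *m v^T) 0 0 by exact: kmx_psd.
have AAsym m n (A : 'M[R]_(m, n)) : (A *m A^T)^T = A *m A^T.
  by rewrite trmx_mul trmxK.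
have AAE m n (A : 'M[R]_(m, n)) (v : 'rV_m) :
    v *m (A *m A^T) *m v^T = v *m A *m (v *m A)^T.
  by rewrite trmx_mul !mulmxA.
have ThetaE : Theta = _ := kmx_theta_B X_S Y_S (samples X_T) k a sigma_S.
rewrite -/aX_T -/K_S in ThetaE.
set T := kmx k aX_T _ in hc ThetaE.
rewrite -(trmx_kmx aX_T (samples X_S) k_sym) -/T in hc.
set M := invmx _ in ThetaE.
have lmin0 : 0 <= lambda_min K_S by exact: lambda_min_ge0.
have lmax : lambda_min K_S <= lambda_max K_S.
  by apply/le_lambda_max/mem_lambda_min.
have lmax0 := le_trans lmin0 lmax.
have Y0 : 0 <= lambda_min (Y_S *m Y_S^T).
  by apply: lambda_min_ge0 => // v; rewrite AAE row_sqr_ge0.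
have Theta_sym : Theta^T = Theta by rewrite ThetaE.
have spec_i : eigval Theta i \in spectrum Theta.
  by apply: mem_nth; rewrite size_spectrum.
(* The bound is the same for every index, so it suffices to bound the quadratic form of [Theta] from
   below. *)
apply: le_spectrum spec_i => v.
rewrite ThetaE AAE !mulmxA; set u := v *m T *m M.
rewrite -AAE mulrAC; apply: le_trans (lambda_min_rayleigh u (AAsym _ _ Y_S)).
(* Cancelling the nonnegative factor [lambda_min (Y_S *m Y_S^T)] leaves a lower bound on |u|^2. *)
rewrite mulrC ler_wpM2l //.
have uK : u *m (K_S + sigma_S%:M) = v *m T by rewrite mulmxKV ?shift_unitmx.
have := lambda_max_shift u Ksym K0 (ltW sigma_S_gt0).
rewrite /= uK -AAE => /(le_trans (lambda_min_rayleigh v (AAsym _ _ T))).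
move=> /(le_trans (ler_wpM2r (row_sqr_ge0 v) hc)) => bound.
have lmaxs : 0 < lambda_max K_S + sigma_S by rewrite ltr_wpDl.
have lmins : 0 < lambda_min K_S + sigma_S by rewrite ltr_wpDl.
(* This is [bound] divided by the positive square of [lambda_max K_S + sigma_S]. *)
have : c_B * (lambda_max K_S / (lambda_max K_S + sigma_S)) ^+ 2 *
    (v *m v^T) 0 0 <= (u *m u^T) 0 0.
  rewrite expr_div_n mulrA mulrAC ler_pdivrMr ?exprn_gt0 //.
  by rewrite [leRHS]mulrC.
apply: le_trans; rewrite ler_wpM2r ?row_sqr_ge0 // ler_wpM2l ?(ltW c_B_gt0) //.
rewrite lerXn2r ?nnegrE ?divr_ge0 ?(ltW lmins) ?(ltW lmaxs) //.
(* Cross-multiplied, the common product of the two eigenvalues drops out and the claim is that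
   [lambda_min K_S * sigma_S] is at most [lambda_max K_S * sigma_S]. *)
rewrite ler_pdivrMr // mulrAC ler_pdivlMr // !mulrDr.
by rewrite [lambda_min _ * lambda_max _]mulrC lerD2l ler_wpM2r // ltW.
Qed.
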